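(* For every integer $n\ge1$, the map $\iota:\mathrm{SCH}_{\mathrm{odd}}(n)\rightarrow \mathrm{SCH}_{\mathrm{even}}'(n)$ (defined in the context) is a bijection; in particular $\iota(L)\in\mathrm{SCH}_{\mathrm{even}}'(n)$ for all $L\in\mathrm{SCH}_{\mathrm{odd}}(n)$.
   Context: A lattice path of length $n$ is a sequence of points in $\mathbb{N}\times\mathbb{N}$ (with $0\in\mathbb{N}$) starting at $(0,0)$ and ending at $(n,0)$. For a lattice path $((x_0,y_0),\dots,(x_k,y_k))$, each $S_i=(x_i-x_{i-1},y_i-y_{i-1})$ is a step, and the height of $S_i$ is $y_{i-1}$. A lattice path is identified with the word $S_1S_2\cdots S_k$ of its steps. Let $U=(1,1)$, $D=(1,-1)$. A Schröder path is a lattice path consisting of steps $U$, $D$ and $H^2=(2,0)$ (where $H^2$ is a single step). A peak of a Schröder path $S_1\cdots S_k$ is a pair $(S_i,S_{i+1})$ of consecutive steps with $S_i=U$, $S_{i+1}=D$; its height is the height of $S_{i+1}$. $\mathrm{SCH}_{\mathrm{odd}}(n)$ (resp. $\mathrm{SCH}_{\mathrm{even}}(n)$) is the set of Schröder paths of length $2n$ which have no peaks of odd (resp. even) height. $\mathrm{SCH}_{\mathrm{even}}'(n)$ is the set of $L\in\mathrm{SCH}_{\mathrm{even}}(n)$ whose first step is $U$. For an up step $S_i=U$ of a Schröder path, the down step corresponding to $S_i$ is the unique down step $S_j=D$ with $i<j$ such that $S_{i+1}\cdots S_{j-1}$ is a (possibly empty) lattice path (when translated to start at the origin, it stays weakly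 above and ends on the $x$-axis); $S_i$ is then called the up step corresponding to $S_j$. The map $\iota$: for $L=S_1S_2\cdots S_k\in\mathrm{SCH}_{\mathrm{odd}}(n)$, (1) if $S_k=H^2$, then $\iota(L)=U S_1\cdots S_{k-1}D$; (2) if $S_k=D$, let $S_i$ be the up step corresponding to $S_k$; then $\iota(L)=U S_1\cdots S_{i-1}\,D\,S_{i+1}\cdots S_{k-1}$. *)

(* Defs.v *)
From mathcomp Require Import all_boot all_order all_algebra.

Set Implicit Arguments.
Unset Strict Implicit.
Unset Printing Implicit Defensive.

Import Order.TTheory GRing.Theory Num.Theory.
Local Open Scope ring_scope.

(* A lattice path is identified with the word of its steps.  Indices are      *)
(* 0-based: w`_i is the step S_{i+1}, going from point w i to point w i.+1.   *)
(* The default value of w`_i is the step (0, 0), which is none of U, D, HH.   *)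
Notation step := (int * int)%type.

Definition U : step := (1, 1).
Definition D : step := (1, -1).
Definition HH : step := (2, 0).

Definition point (w : seq step) (i : nat) : int * int :=
  \sum_(S <- take i w) S.

Definition height (w : seq step) (i : nat) : int := (point w i).2.

Definition path_length (w : seq step) : int := (point w (size w)).1.

Definition lattice_path (w : seq step) : bool :=
  [forall i : 'I_(size w).+1, (0 <= (point w i).1) && (0 <= (point w i).2)]
  && ((point w (size w)).2 == 0).

Definition schroeder_path (w : seq step) : bool :=
  lattice_path w && all (fun S => S \in [:: U; D; HH]) w.

Definition peak (w : seq step) (i : nat) : bool :=
  (w`_i == U) && (w`_i.+1 == D).

Definition peak_height (w : seq step) (i : nat) : int := height w i.+1.

(* Heights along a lattice path are nonnegative, so absz only casts to nat.   *)
Definition SCH_odd (n : nat) (w : seq step) : bool :=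
  [&& schroeder_path w, path_length w == (2 * n)%N%:Z
    & [forall i : 'I_(size w), peak w i ==> ~~ odd `|peak_height w i|%N]].

Definition SCH_even (n : nat) (w : seq step) : bool :=
  [&& schroeder_path w, path_length w == (2 * n)%N%:Z
    & [forall i : 'I_(size w), peak w i ==> odd `|peak_height w i|%N]].

Definition SCH_even' (n : nat) (w : seq step) : bool :=
  SCH_even n w && (w`_0 == U).

(* The word strictly between w`_i and w`_j.                                   *)
Definition between (w : seq step) (i j : nat) : seq step :=
  take (j - i.+1) (drop i.+1 w).

Definition corresponding (w : seq step) (i j : nat) : bool :=
  [&& (i < j)%N, w`_i == U, w`_j == D & lattice_path (between w i j)].

(* In a Schroeder path with w`_j = D there is exactly one i such that         *)
(* corresponding w i j, so taking the least one is only a way to select it.   *)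
Definition up_step_of (w : seq step) (j : nat) : nat :=
  find (fun i => corresponding w i j) (iota 0 j).

(* The map called iota in the literature; the name iota is taken in seq.v.    *)
(* A nonempty Schroeder path never ends with U, hence the last branch is      *)
(* irrelevant on SCH_odd n for n >= 1.                                        *)
Definition iota_map (w : seq step) : seq step :=
  let k := (size w).-1 in
  if w`_k == HH then U :: rcons (take k w) D
  else if w`_k == D then
    let i := up_step_of w k in
    U :: take i w ++ D :: between w i k
  else w.

(* Main.v *)
Require Import Defs.
From mathcomp Require Import all_boot all_order all_algebra.
From mathcomp Require Import zify.

(** Cutting at the up step matched with the last step, a path in SCH_odd(n) is
    [P HH], or [P U Q D] with [Q] nonempty (an empty [Q] would make a peak of
    height 1).  Cutting at the first return to the axis, a path in
    SCH_even'(n) is [U P D Q].  The map iota sends [P HH] to [U P D] and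
    [P U Q D] to [U P D Q]; in both cases the path is changed only by moving
    [P] up by one and [Q] down by one, which exchanges the two conditions on
    the parity of the peaks. *)

Set Implicit Arguments.
Unset Strict Implicit.
Unset Printing Implicit Defensive.

Import Order.TTheory GRing.Theory Num.Theory.
Local Open Scope ring_scope.

Implicit Types (w u v P Q : seq step) (s : step) (b p : bool) (h : int).

(** * Displacements, and path conditions read step by step *)

Definition xdisp w : int := \sum_(s <- w) s.1.
Definition ydisp w : int := \sum_(s <- w) s.2.

Definition schroeder_steps w := all (fun s => s \in [:: U; D; HH]) w.

(** The free starting height lets the condition split along concatenations and lets a factor be
    moved up. *)
Fixpoint nonneg_from h w : bool :=
  (0 <= h) && (if w is s :: w' then nonneg_from (h + s.2) w' else true).

(* [p] records whether the step just before [w] is [U]. *)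
Fixpoint peaks_ok b p h w : bool :=
  if w is s :: w' then
    (p && (s == D) ==> (odd (absz h) == b)) && peaks_ok b (s == U) (h + s.2) w'
  else true.

Definition balanced w := [&& schroeder_steps w, nonneg_from 0 w & ydisp w == 0].

Lemma xdisp_nil : xdisp [::] = 0. Proof. exact: big_nil. Qed.
Lemma ydisp_nil : ydisp [::] = 0. Proof. exact: big_nil. Qed.
Lemma xdisp_cons s w : xdisp (s :: w) = s.1 + xdisp w.
Proof. exact: big_cons. Qed.
Lemma ydisp_cons s w : ydisp (s :: w) = s.2 + ydisp w.
Proof. exact: big_cons. Qed.
Lemma xdisp_cat u v : xdisp (u ++ v) = xdisp u + xdisp v.
Proof. exact: big_cat. Qed.
Lemma ydisp_cat u v : ydisp (u ++ v) = ydisp u + ydisp v.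
Proof. exact: big_cat. Qed.

Definition dispE :=
  (xdisp_cat, ydisp_cat, xdisp_cons, ydisp_cons, xdisp_nil, ydisp_nil).

Lemma point_fst w i : (point w i).1 = xdisp (take i w).
Proof. exact: (big_morph fst). Qed.

Lemma point_snd w i : (point w i).2 = ydisp (take i w).
Proof. exact: (big_morph snd). Qed.

Lemma schroeder_stepP s : s \in [:: U; D; HH] -> [\/ s = U, s = D | s = HH].
Proof.
by rewrite !inE => /or3P[] /eqP->; [constructor 1|constructor 2|constructor 3].
Qed.

Lemma schroeder_steps_cat u v :
  schroeder_steps (u ++ v) = schroeder_steps u && schroeder_steps v.
Proof. exact: all_cat. Qed.

Lemma xdisp_ge0 w : schroeder_steps w -> 0 <= xdisp w.
Proof.
elim: w => [|s w IHw]; first by rewrite xdisp_nil.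
by move=> /= /andP[/schroeder_stepP hS /IHw]; rewrite xdisp_cons;
  case: hS => -> /=; lia.
Qed.

Lemma nonneg_from_ge0 h w : nonneg_from h w -> 0 <= h.
Proof. by case: w => [|s w] /= /andP[]. Qed.

Lemma nonneg_from_cat h u v :
  nonneg_from h (u ++ v) = nonneg_from h u && nonneg_from (h + ydisp u) v.
Proof.
elim: u h => [|s u IHu] h /=.
  rewrite ydisp_nil addr0 andbT; case: v => [|s v] /=; last by rewrite andbA andbb.
  by rewrite andbT andbb.
by rewrite IHu ydisp_cons addrA andbA.
Qed.

Lemma nonneg_from_mono h h' w : h <= h' -> nonneg_from h w -> nonneg_from h' w.
Proof.
elim: w h h' => [|s w IHw] h h' le_h /= /andP[h_ge0]; rewrite (le_trans h_ge0) //.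
by apply: IHw; rewrite lerD2r.
Qed.

Lemma nonneg_from_end h w : nonneg_from h w -> 0 <= h + ydisp w.
Proof.
rewrite -{1}[w]cats0 nonneg_from_cat => /andP[_]; exact: nonneg_from_ge0.
Qed.

Lemma nonneg_fromP h w :
  reflect (forall i, 0 <= h + ydisp (take i w)) (nonneg_from h w).
Proof.
apply: (iffP idP) => [w_ge0 i|].
  apply: nonneg_from_end.
  by move: w_ge0; rewrite -{1}[w](cat_take_drop i) nonneg_from_cat => /andP[].
elim: w h => [|s w IHw] h hw /=; have := hw 0%N; rewrite take0 ydisp_nil addr0 => -> //=.
by apply: IHw => i; have := hw i.+1; rewrite /= ydisp_cons addrA.
Qed.

(** Every step moves to the right, so the condition on abscissas is automatic and only heights
    matter. *)
Lemma lattice_path_balanced w :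
  schroeder_steps w -> lattice_path w = balanced w.
Proof.
move=> w_steps; rewrite /lattice_path /balanced w_steps /= point_snd take_size.
congr (_ && _); apply/forallP/nonneg_fromP => [w_ge0 i|w_ge0 i].
  rewrite add0r; have [le_i|lt_i] := leqP i (size w).
    by have /andP[_] := w_ge0 (Ordinal (le_i : (i < (size w).+1)%N)); rewrite point_snd.
  (* Beyond the end of the word, [take] returns all of [w], whose height is that of the last
     point. *)
  rewrite take_oversize 1?ltnW //.
  by have /andP[_] := w_ge0 ord_max; rewrite point_snd take_size.
rewrite point_fst point_snd; have := w_ge0 i; rewrite add0r => ->.
rewrite andbT xdisp_ge0 //.
by move: w_steps; rewrite -{1}[w](cat_take_drop i) schroeder_steps_cat => /andP[].
Qed.

Lemma schroeder_path_balanced w : schroeder_path w = balanced w.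
Proof.
rewrite /schroeder_path -/(schroeder_steps w).
have [w_steps|/negPf w_steps] := boolP (schroeder_steps w).
  by rewrite andbT lattice_path_balanced.
by rewrite andbF /balanced w_steps.
Qed.

(** * Building balanced words, and their end steps *)

Lemma balanced_cat u v : balanced u -> balanced (u ++ v) = balanced v.
Proof.
case/and3P=> u_steps u_ge0 /eqP u0.
by rewrite /balanced schroeder_steps_cat u_steps nonneg_from_cat u_ge0 u0 addr0
  ydisp_cat u0 add0r.
Qed.

Lemma balanced_arch P Q : balanced P -> balanced Q -> balanced (U :: P ++ D :: Q).
Proof.
case/and3P=> P_steps P_ge0 /eqP P0 /and3P[Q_steps Q_ge0 /eqP Q0].
rewrite /balanced /= schroeder_steps_cat P_steps /= Q_steps nonneg_from_cat /=.
rewrite (nonneg_from_mono _ P_ge0) // !dispE P0 Q0 /= Q_ge0.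
by [].
Qed.

Lemma balanced_flat : balanced [:: HH].
Proof. by rewrite /balanced /= !dispE. Qed.

Lemma balanced_nil : balanced [::].
Proof. by rewrite /balanced /= !dispE. Qed.

(** The default [HH], neither [U] nor [D], covers the empty word here and in the next lemma. *)
Lemma balanced_head_neqD P : balanced P -> head HH P != D.
Proof. by case: P => [|s P] //= /and3P[_ P_ge0 _]; apply: contraTneq P_ge0 => ->; case: P. Qed.

Lemma balanced_last_neqU P : balanced P -> last HH P != U.
Proof.
case/lastP: P => [|P s] //; rewrite last_rcons -cats1 => /and3P[_].
rewrite nonneg_from_cat => /andP[/nonneg_from_end + _] /eqP.
rewrite !dispE => P_ge0 P0; apply/eqP => S_U; move: P0 P_ge0; rewrite S_U /=; lia.
Qed.

(** * Existence and uniqueness of the two decompositions *)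

(** Strong induction on the size. After a leading [U], the induction hypothesis is used twice: once
    to come back to the axis, and once on the remainder [v], which still ends below it. *)
Lemma first_return w : schroeder_steps w -> ydisp w < 0 ->
  exists P Q, w = P ++ D :: Q /\ balanced P.
Proof.
have [m] := ubnP (size w); elim: m w => // m IHm [|s w] /=; rewrite ?dispE //.
rewrite ltnS => lt_w /andP[/schroeder_stepP[]-> w_steps] /= w_lt0.
- have [|P1 [v [w_eq P1_bal]]] := IHm w lt_w w_steps; first by lia.
  have v_lt0 : ydisp v < 0.
    move: w_lt0; rewrite w_eq !dispE; have/and3P[_ _ /eqP->] := P1_bal.
    by rewrite /=; lia.
  have v_steps : schroeder_steps v.
    by move: w_steps; rewrite w_eq schroeder_steps_cat => /andP[_ /andP[]].
  have [|P2 [Q [v_eq P2_bal]]] := IHm v _ v_steps v_lt0.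
    by move: lt_w; rewrite w_eq size_cat /=; lia.
  exists (U :: P1 ++ D :: P2), Q; split; last exact: balanced_arch.
  by rewrite w_eq v_eq /= -catA.
- by exists [::], w; split; last exact: balanced_nil.
- have [|P [Q [-> P_bal]]] := IHm w lt_w w_steps; first by lia.
  by exists (HH :: P), Q; split; last rewrite (@balanced_cat [:: HH]) ?balanced_flat.
Qed.

(** Mirror image of [first_return], peeling steps off the end of the word. *)
Lemma last_ascent w : schroeder_steps w -> 0 < ydisp w ->
  exists P Q, w = P ++ U :: Q /\ balanced Q.
Proof.
have [m] := ubnP (size w); elim: m w => // m IHm w.
case/lastP: w => [|w s]; rewrite -?cats1 ?dispE // size_cat addn1 ltnS => lt_w.
rewrite schroeder_steps_cat /= andbT.
case/andP=> w_steps /schroeder_stepP[]-> /=; rewrite addr0 => w_gt0.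
- by exists w, [::]; split; last exact: balanced_nil.
- have [|v [Q1 [w_eq Q1_bal]]] := IHm w lt_w w_steps; first by lia.
  have v_gt0 : 0 < ydisp v.
    move: w_gt0; rewrite w_eq !dispE; have/and3P[_ _ /eqP->] := Q1_bal.
    by rewrite /=; lia.
  have v_steps : schroeder_steps v.
    by move: w_steps; rewrite w_eq schroeder_steps_cat => /andP[].
  have [|P [Q2 [v_eq Q2_bal]]] := IHm v _ v_steps v_gt0.
    by move: lt_w; rewrite w_eq size_cat /=; lia.
  exists P, (Q2 ++ U :: Q1 ++ [:: D]); split.
    by rewrite w_eq v_eq -!catA.
  by rewrite balanced_cat // balanced_arch // balanced_nil.
- have [|P [Q [-> Q_bal]]] := IHm w lt_w w_steps; first by lia.
  exists P, (Q ++ [:: HH]); split; first by rewrite -catA.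
  by rewrite balanced_cat ?balanced_flat.
Qed.

(** Common start of both uniqueness proofs: of two marked occurrences of [x], the earlier one lies
    inside the longer prefix. *)
Lemma cat_cons_split (T : Type) (s1 s2 t1 t2 : seq T) (x : T) :
  s1 ++ x :: t1 = s2 ++ x :: t2 -> (size s1 < size s2)%N ->
  exists r, s2 = s1 ++ x :: r /\ t1 = r ++ x :: t2.
Proof.
elim: s1 s2 => [|y s1 IHs] [|z s2] //=; first by case=> -> ->; exists s2.
by case=> -> /IHs + lt_s => /(_ lt_s)[r [-> ->]]; exists r.
Qed.

(** If one prefix were shorter, the other would continue it with a [D] from height 0, below the
    axis. *)
Lemma first_return_uniq P Q P' Q' : balanced P -> balanced P' ->
  P ++ D :: Q = P' ++ D :: Q' -> P = P' /\ Q = Q'.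
Proof.
have not_shorter P1 Q1 P2 Q2 : balanced P1 -> balanced P2 ->
    P1 ++ D :: Q1 = P2 ++ D :: Q2 -> ~~ (size P1 < size P2)%N.
  move=> P1_bal + eqPQ; apply: contraTN => /(cat_cons_split eqPQ)[r [-> _]].
  rewrite balanced_cat //; apply/negP => /balanced_head_neqD.
  by rewrite eqxx.
move=> P_bal P'_bal eqPQ.
have := not_shorter _ _ _ _ P'_bal P_bal (esym eqPQ).
have := not_shorter _ _ _ _ P_bal P'_bal eqPQ.
rewrite -!leqNgt => le1 le2.
have /eqP eq_sz : size P == size P' by rewrite eqn_leq le1 le2.
by move/eqP: eqPQ; rewrite eqseq_cat // => /andP[/eqP-> /eqP[->]].
Qed.

(** If one prefix were shorter, its balanced suffix would be [r ++ U :: Q2] with [Q2] balanced, so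
    [r] would end at height -1. *)
Lemma last_ascent_uniq P Q P' Q' : balanced Q -> balanced Q' ->
  P ++ U :: Q = P' ++ U :: Q' -> size P = size P'.
Proof.
have not_shorter P1 Q1 P2 Q2 : balanced Q1 -> balanced Q2 ->
    P1 ++ U :: Q1 = P2 ++ U :: Q2 -> ~~ (size P1 < size P2)%N.
  move=> /and3P[_ Q1_ge0 /eqP Q1_0] /and3P[_ _ /eqP Q2_0] eqPQ; apply/negP => /(cat_cons_split eqPQ)[r [_ Q1_eq]].
  move: Q1_0 Q1_ge0; rewrite Q1_eq nonneg_from_cat !dispE Q2_0 /=.
  by move=> r_eq /andP[/nonneg_from_end]; lia.
move=> Q_bal Q'_bal eqPQ.
have := not_shorter _ _ _ _ Q'_bal Q_bal (esym eqPQ).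
have := not_shorter _ _ _ _ Q_bal Q'_bal eqPQ.
rewrite -!leqNgt => le1 le2.
by apply/eqP; rewrite eqn_leq le1 le2.
Qed.

(** * Parity of peak heights *)

Lemma odd_absz_succ h : odd (absz (h + 1)) = ~~ odd (absz h).
Proof. lia. Qed.

(** This is where the two parity conditions are exchanged: raising a word by one flips the parity of
    all its peaks. *)
Lemma peaks_ok_succ b p h w : peaks_ok b p (h + 1) w = peaks_ok (~~ b) p h w.
Proof.
elim: w p h => //= s w IHw p h; rewrite addrAC IHw odd_absz_succ.
by case: (odd _); case: b {IHw}.
Qed.

Lemma peaks_ok_cat b p h u v :
  peaks_ok b p h (u ++ v) = peaks_ok b p h u
    && peaks_ok b (if u is s :: u' then last s u' == U else p) (h + ydisp u) v.
Proof.
elim: u p h => [|s u IHu] p h /=; first by rewrite ydisp_nil addr0.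
by rewrite IHu ydisp_cons addrA andbA; case: u {IHu}.
Qed.

(** No peak straddles the junction, since a balanced word does not end with [U]. *)
Lemma peaks_ok_balanced_cat b h u v : balanced u ->
  peaks_ok b false h (u ++ v) = peaks_ok b false h u && peaks_ok b false h v.
Proof.
move=> u_bal; rewrite peaks_ok_cat; have/and3P[_ _ /eqP->] := u_bal.
rewrite addr0; case: u u_bal => // s u /balanced_last_neqU /=.
by case: (last _ _ == U).
Qed.

(** The outer [U] and [D] take part in a peak only when they are adjacent, because [P] neither
    starts with [D] nor ends with [U]. *)
Lemma peaks_ok_arch b h P v : balanced P ->
  peaks_ok b false h (U :: P ++ D :: v) =
  [&& nilp P ==> (odd (absz (h + 1)) == b), peaks_ok b false (h + 1) P
    & peaks_ok b false h v].
Proof.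
move=> P_bal; have h1 : h + 1 + -1 = h by rewrite addrK.
case: P P_bal => [|s P] P_bal /=; first by rewrite h1.
have SP0 : h + 1 + s.2 + ydisp P = h + 1.
  by move: P_bal => /and3P[_ _]; rewrite ydisp_cons => /eqP; lia.
rewrite (negPf (balanced_head_neqD P_bal : s != D)) /= peaks_ok_cat SP0 /= h1.
have := balanced_last_neqU P_bal; rewrite /= => last_neqU.
have -> : (if P is s' :: u' then last s' u' == U else s == U) = false.
  by case: P last_neqU {P_bal SP0} => [|s' P] /negPf.
by [].
Qed.

Lemma peaks_okP b p h w :
  reflect ((p -> w`_0 = D -> odd (absz h) = b) /\
           (forall i, peak w i -> odd (absz (h + ydisp (take i.+1 w))) = b))
          (peaks_ok b p h w).
Proof.
elim: w p h => [|s w IHw] p h /=.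
  by constructor; split=> // i; rewrite /peak nth_nil.
apply: (iffP andP) => [[hp /IHw[hS hw]]|[hp hw]]; split.
- by move=> p_true S_D; move: hp; rewrite p_true S_D eqxx => /eqP.
- case=> [|i] /=; rewrite ydisp_cons addrA; last exact: hw.
  rewrite take0 ydisp_nil addr0 => /andP[/eqP S_U /eqP w_D]; apply: hS => //.
  exact/eqP.
- by apply/implyP=> /andP[p_true /eqP S_D]; rewrite hp.
apply/IHw; split=> [/eqP S_U w_D|i w_i].
  have := hw 0%N; rewrite /peak /= S_U w_D !eqxx take0 !dispE addr0.
  by apply.
by have := hw i.+1 w_i; rewrite /= ydisp_cons addrA.
Qed.

Lemma forall_peakE b w :
  [forall i : 'I_(size w), peak w i ==> (odd `|peak_height w i|%N == b)]
  = peaks_ok b false 0 w.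
Proof.
apply/forallP/peaks_okP => [hw|[_ hw] i].
  (* Outside the word the default step [(0, 0)] is not [U], so every peak index is in range. *)
  split=> // i pk; have lt_i : (i < size w)%N.
    rewrite ltnNge; apply/negP => le_i; move: pk.
    by rewrite /peak nth_default.
  have /implyP/(_ pk)/eqP := hw (Ordinal lt_i).
  by rewrite /peak_height /height point_snd add0r.
apply/implyP => /hw; rewrite add0r /peak_height /height point_snd => ->.
exact: eqxx.
Qed.

(** * Both families of paths parametrized by pairs of balanced words *)

Lemma path_lengthE w : path_length w = xdisp w.
Proof. by rewrite /path_length point_fst take_size. Qed.

Lemma SCH_oddE n w :
  SCH_odd n w = [&& balanced w, xdisp w == (2 * n)%N%:Z & peaks_ok false false 0 w].
Proof.
rewrite /SCH_odd schroeder_path_balanced path_lengthE -forall_peakE.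
by under [in RHS]eq_forallb do rewrite eqbF_neg.
Qed.

Lemma SCH_evenE n w :
  SCH_even n w = [&& balanced w, xdisp w == (2 * n)%N%:Z & peaks_ok true false 0 w].
Proof.
rewrite /SCH_even schroeder_path_balanced path_lengthE -forall_peakE.
by under [in RHS]eq_forallb do rewrite eqb_id.
Qed.

(* The paths of SCH_odd are parametrized by the same pairs [(P, Q)] as those of
   SCH_even', an empty [Q] standing for a final [HH]. *)
Definition glue P Q := if nilp Q then rcons P HH else P ++ U :: rcons Q D.

(** The lengths agree because [HH] is as wide as [U] and [D] together. For empty [P] the right-hand
    path gains a peak of height 1, which is allowed there; for nonempty [Q] the arch on the left
    makes no peak of its own. *)
Lemma SCH_odd_glue n P Q : balanced P -> balanced Q ->
  SCH_odd n (glue P Q) = SCH_even' n (U :: P ++ D :: Q).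
Proof.
move=> P_bal Q_bal.
rewrite /SCH_even' eqxx andbT SCH_oddE SCH_evenE balanced_arch //.
rewrite peaks_ok_arch // peaks_ok_succ /= implybT /=.
rewrite /glue; case: nilP => [->|/nilP/negPf Q_nil].
  rewrite -cats1 balanced_cat // balanced_flat peaks_ok_balanced_cat // !dispE /=.
  by congr (_ && _); lia.
rewrite -cats1 balanced_cat // balanced_arch ?balanced_nil //.
rewrite peaks_ok_balanced_cat // peaks_ok_arch // Q_nil peaks_ok_succ !dispE /= andbT.
by congr (_ && _); lia.
Qed.

Lemma SCH_odd_exists_glue n w : (1 <= n)%N -> SCH_odd n w ->
  exists P Q, [/\ balanced P, balanced Q & w = glue P Q].
Proof.
move=> n_gt0; rewrite SCH_oddE => /and3P[+ + +].
(* The empty word is excluded by [n_gt0]. *)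
case/lastP: w => [|w s]; first by rewrite xdisp_nil; lia.
move=> wS_bal _; move: (wS_bal); rewrite -cats1 => /and3P[].
rewrite schroeder_steps_cat nonneg_from_cat !dispE addr0 => /andP[w_steps].
rewrite /schroeder_steps all_seq1 => S_step /andP[w_ge0 _] /eqP w0 pk_w.
have S_neqU : s != U by have := balanced_last_neqU wS_bal; rewrite last_rcons.
case: (schroeder_stepP S_step) S_neqU w0 pk_w => -> // _; rewrite /= => w0.
  (* Before the final [D] the height is 1, so a last ascent from the axis exists. *)
  have [|P [Q [w_eq Q_bal]]] := last_ascent w_steps; first by lia.
  move: w_steps w_ge0 w0; rewrite w_eq schroeder_steps_cat nonneg_from_cat !dispE /=.
  have/and3P[_ _ /eqP->] := Q_bal => /andP[P_steps _] /andP[P_ge0 _] P0.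
  have P_bal : balanced P by rewrite /balanced P_steps P_ge0; apply/eqP; lia.
  rewrite -catA /= peaks_ok_balanced_cat // peaks_ok_arch // implybF => /and3P[_ Q_nil _].
  exists P, Q; split=> //.
  by rewrite /glue (negPf Q_nil) cats1.
rewrite cats1 => _; exists w, [::]; split=> //; last exact: balanced_nil.
by rewrite /balanced w_steps w_ge0; apply/eqP; lia.
Qed.

Lemma SCH_even'_first_return n w : SCH_even' n w ->
  exists P Q, [/\ balanced P, balanced Q & w = U :: P ++ D :: Q].
Proof.
case/andP; rewrite SCH_evenE => /and3P[w_bal _ _].
case: w w_bal => // s w + /eqP /= S_U; rewrite S_U.
case/and3P=> /andP[_ w_steps] /= w_ge0; rewrite ydisp_cons => /eqP /= w0.
have [|P [Q [w_eq P_bal]]] := first_return w_steps; first by lia.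
exists P, Q; split; rewrite ?w_eq //.
move: (w_steps : schroeder_steps w) w_ge0 w0.
rewrite w_eq schroeder_steps_cat nonneg_from_cat !dispE.
have/and3P[_ _ /eqP->] := P_bal.
move=> /andP[_ /andP[_ Q_steps]] /andP[_ /andP[_ Q_ge0]] /= Q0.
(* The height after [U], [P] and [D] computes to 0, so the casts hold by conversion. *)
rewrite /balanced (Q_steps : schroeder_steps Q) (Q_ge0 : nonneg_from 0 Q).
by apply/eqP; lia.
Qed.

(** * The value of [iota_map] on glued words *)

Lemma nth_between_cat w i j : (i < j)%N -> (j < size w)%N ->
  w = take i w ++ w`_i :: between w i j ++ w`_j :: drop j.+1 w.
Proof.
move=> lt_ij lt_j; have lt_i := ltn_trans lt_ij lt_j.
rewrite -[LHS](cat_take_drop i) (drop_nth 0) // /between.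
rewrite -[drop i.+1 w in LHS](cat_take_drop (j - i.+1)) drop_drop subnK //.
by rewrite (drop_nth 0 lt_j).
Qed.

(** For nonempty [Q] the point is to locate the up step matched with the final [D]: position
    [size P] qualifies, and by [last_ascent_uniq] no other position does, so the search must return
    it. *)
Lemma iota_map_glue P Q : balanced P -> balanced Q ->
  iota_map (glue P Q) = U :: P ++ D :: Q.
Proof.
move=> P_bal Q_bal; rewrite /iota_map /glue; case: nilP => [->|/nilP Q_nil].
  by rewrite size_rcons nth_rcons ltnn !eqxx -[rcons P HH]cats1 take_size_cat ?cats1.
set w := P ++ U :: rcons Q D; set k := (size P + (size Q).+1)%N.
have w_eq : w = rcons (P ++ U :: Q) D by rewrite rcons_cat.
have sz_w : size w = k.+1 by rewrite w_eq size_rcons size_cat.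
have w_k : w`_k = D.
  by rewrite w_eq nth_rcons size_cat /= ltnn eqxx.
have w_P : w`_(size P) = U by rewrite /w nth_cat ltnn subnn.
have bet : between w (size P) k = Q.
  rewrite /between /w drop_cat ltnNge leqnSn /= subSnn /= drop0.
  by rewrite /k addnS subSS addKn -cats1 take_size_cat.
rewrite sz_w /= w_k /=.
suff -> : up_step_of w k = size P by rewrite bet /w take_size_cat.
have w_steps : schroeder_steps w.
  have/and3P[P_steps _ _] := P_bal; have/and3P[Q_steps _ _] := Q_bal.
  by rewrite /w -cats1 /= schroeder_steps_cat P_steps /= schroeder_steps_cat Q_steps.
have lt_Pk : (size P < k)%N by rewrite /k; lia.
have cor_P : corresponding w (size P) k.
  have/and3P[Q_steps _ _] := Q_bal.
  by rewrite /corresponding lt_Pk w_P w_k bet lattice_path_balanced ?Q_bal ?eqxx.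
have cor_uniq i : corresponding w i k -> i = size P.
  case/and4P=> lt_ik /eqP w_i _ bet_lat.
  have lt_kw : (k < size w)%N by rewrite sz_w.
  have := nth_between_cat lt_ik lt_kw.
  rewrite w_i w_k drop_oversize ?sz_w // => w_dec.
  have bet_bal : balanced (between w i k).
    rewrite -lattice_path_balanced //.
    move: w_steps; rewrite {1}w_dec schroeder_steps_cat => /andP[_ /andP[_ v_steps]].
    by move: (v_steps : schroeder_steps (_ ++ _)); rewrite schroeder_steps_cat => /andP[].
  have dec_eq : P ++ U :: Q = take i w ++ U :: between w i k.
    have := w_eq; rewrite {1}w_dec -cat_cons catA cats1 => /rcons_inj[].
    by [].
  have := last_ascent_uniq Q_bal bet_bal dec_eq; rewrite size_takel //.
  by rewrite sz_w; lia.
have hasP : has (corresponding w ^~ k) (iota 0 k).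
  by apply/hasP; exists (size P) => //; rewrite mem_iota.
(* The entry found in [iota 0 k] equals its own index, so [cor_uniq] applies to the index itself. *)
have := nth_find 0%N hasP; rewrite nth_iota; last by rewrite -[X in (_ < X)%N](size_iota 0) -has_find.
exact: cor_uniq.
Qed.

(** * Bijectivity *)

(** The inverse picks a preimage with [xchoose], which takes a boolean predicate; hence the equation
    is restated with [==]. *)
Lemma inj_surj_bij (A B : choiceType) (f : A -> B) :
  injective f -> (forall y, exists x, f x = y) -> bijective f.
Proof.
move=> f_inj f_surj.
have f_surjb y : exists x, f x == y by have [x <-] := f_surj y; exists x.
have fK : cancel (fun y => xchoose (f_surjb y)) f.
  by move=> y; apply/eqP; exact: (xchooseP (f_surjb y)).
exact: Bijective (inj_can_sym fK f_inj) fK.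
Qed.

Theorem mainTheorem4 (n : nat) (hn : (1 <= n)%N) :
  (forall L : seq step, SCH_odd n L -> SCH_even' n (iota_map L)) /\
  (exists f : {L : seq step | SCH_odd n L} -> {L : seq step | SCH_even' n L},
     (forall L, sval (f L) = iota_map (sval L)) /\ bijective f).
Proof.
have iota_even L : SCH_odd n L -> SCH_even' n (iota_map L).
  move=> L_odd; have [P [Q [P_bal Q_bal L_eq]]] := SCH_odd_exists_glue hn L_odd.
  by rewrite L_eq iota_map_glue // -SCH_odd_glue // -L_eq.
split=> //.
exists (fun L => exist _ (iota_map (sval L)) (iota_even _ (svalP L))); split=> //.
apply: inj_surj_bij => [[L L_odd] [L' L'_odd]|[w w_even]].
  move=> /(congr1 sval) /= eq_iota; apply: val_inj => /=; move: eq_iota.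
  have [P [Q [P_bal Q_bal ->]]] := SCH_odd_exists_glue hn L_odd.
  have [P' [Q' [P'_bal Q'_bal ->]]] := SCH_odd_exists_glue hn L'_odd.
  rewrite !iota_map_glue // => -[eqPQ].
  by have [-> ->] := first_return_uniq P_bal P'_bal eqPQ.
have [P [Q [P_bal Q_bal w_eq]]] := SCH_even'_first_return w_even.
(* The preimage glues the two factors of the first-return decomposition. *)
have L_odd : SCH_odd n (glue P Q) by rewrite SCH_odd_glue // -w_eq.
by exists (Sub (glue P Q) L_odd); apply: val_inj; rewrite /= iota_map_glue.
Qed.
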